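(* Let $a\in\mathbf{C}$. Every 2-local derivation of the transposed Poisson algebra $\mathcal{W}(a,-1)$ is a derivation; that is, the set of 2-local derivations of $\mathcal{W}(a,-1)$ equals the set of derivations of $\mathcal{W}(a,-1)$.
   Context: All algebras are over $\mathbf{C}$. For $a\in\mathbf{C}$, the transposed Poisson algebra $\mathcal{W}(a,-1)$ is the vector space with basis $\{L_n,I_m\mid n,m\in\mathbf{Z}\}$, with commutative associative product $L_n\cdot L_m=L_{n+m}$, $L_n\cdot I_m=I_{n+m}$, $I_n\cdot I_m=0$, and Lie bracket $[L_n,L_m]=(n-m)L_{n+m}$, $[L_n,I_m]=-(m+a-n)I_{n+m}$, $[I_n,I_m]=0$. A derivation is a linear map $\Delta$ satisfying $\Delta(x\star y)=\Delta(x)\star y+x\star\Delta(y)$ for all $x,y$ and for both products $\star\in\{\cdot,[\ ,\ ]\}$. A (not necessarily linear) map $D$ is a 2-local derivation if for any elements $x,y$ there exists a derivation $\Delta_{x,y}$ with $D(x)=\Delta_{x,y}(x)$ and $D(y)=\Delta_{x,y}(y)$. *)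

(* Defs.v *)
From HB Require Import structures.
From mathcomp Require Import all_boot all_order all_algebra.
From mathcomp Require Import finmap reals complex monalg.

Set Implicit Arguments.
Unset Strict Implicit.
Unset Printing Implicit Defensive.

Import GRing.Theory.
Local Open Scope ring_scope.

Section Derivations.
Variables (K : nzRingType) (V : lmodType K) (mul br : V -> V -> V).

Definition leibniz (op : V -> V -> V) (D : V -> V) : Prop :=
  forall x y, D (op x y) = op (D x) y + op x (D y).

Definition derivation (D : V -> V) : Prop :=
  [/\ linear D, leibniz mul D & leibniz br D].

(* No linearity is required of D. *)
Definition two_local_derivation (D : V -> V) : Prop :=
  forall x y, exists Delta : V -> V,
    [/\ derivation Delta, D x = Delta x & D y = Delta y].

End Derivations.

(* Bilinear extension of a product given on the basis << k >>, k : B, of the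
   free module {malg K[B]} of finitely supported functions B -> K. *)
Definition bilin_ext (K : nzRingType) (B : choiceType)
    (t : B -> B -> {malg K[B]}) (x y : {malg K[B]}) : {malg K[B]} :=
  \sum_(i <- msupp x) \sum_(j <- msupp y) (x@_i * y@_j) *: t i j.

Lemma bilin_extU (K : nzRingType) (B : choiceType)
    (t : B -> B -> {malg K[B]}) (i j : B) :
  bilin_ext t << i >> << j >> = t i j.
Proof.
by rewrite /bilin_ext !msuppU oner_eq0 !big_seq_fset1 !mcoeffUU mulr1 scale1r.
Qed.

Section W.
Variable R : realType.

(* inl n is the index of L_n and inr m that of I_m. *)
Definition W : lmodType R[i] := {malg R[i][(int + int)%type]}.

Definition Lb (n : int) : W := << inl n >>.
Definition Ib (m : int) : W := << inr m >>.

Definition mul_basis (i j : int + int) : W :=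
  match i, j with
  | inl n, inl m => Lb (n + m)
  | inl n, inr m => Ib (n + m)
  | inr n, inl m => Ib (n + m)
  | inr _, inr _ => 0
  end.

(* The (inr, inl) entry is determined by antisymmetry. *)
Definition br_basis (a : R[i]) (i j : int + int) : W :=
  match i, j with
  | inl n, inl m => (n - m)%:~R *: Lb (n + m)
  | inl n, inr m => - (m%:~R + a - n%:~R) *: Ib (n + m)
  | inr n, inl m => (n%:~R + a - m%:~R) *: Ib (n + m)
  | inr _, inr _ => 0
  end.

Definition W_mul : W -> W -> W := bilin_ext mul_basis.
Definition W_br (a : R[i]) : W -> W -> W := bilin_ext (br_basis a).

Lemma W_mulLL n m : W_mul (Lb n) (Lb m) = Lb (n + m).
Proof. exact: bilin_extU. Qed.

Lemma W_mulLI n m : W_mul (Lb n) (Ib m) = Ib (n + m).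
Proof. exact: bilin_extU. Qed.

Lemma W_mulIL n m : W_mul (Ib n) (Lb m) = Ib (n + m).
Proof. exact: bilin_extU. Qed.

Lemma W_mulII n m : W_mul (Ib n) (Ib m) = 0.
Proof. exact: bilin_extU. Qed.

Lemma W_brLL a n m : W_br a (Lb n) (Lb m) = (n - m)%:~R *: Lb (n + m).
Proof. exact: bilin_extU. Qed.

Lemma W_brLI a n m :
  W_br a (Lb n) (Ib m) = - (m%:~R + a - n%:~R) *: Ib (n + m).
Proof. exact: bilin_extU. Qed.

Lemma W_brIL a n m : W_br a (Ib n) (Lb m) = - W_br a (Lb m) (Ib n).
Proof.
by rewrite W_brLI /W_br bilin_extU /= -scaleNr opprK [m + n]addrC.
Qed.

Lemma W_brII a n m : W_br a (Ib n) (Ib m) = 0.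
Proof. exact: bilin_extU. Qed.

End W.

(* Main.v *)
From HB Require Import structures.
Require Import Defs.
From mathcomp Require Import all_boot all_order all_algebra.
From mathcomp Require Import finmap reals complex monalg ring.

(** A derivation vanishing on an element vanishes on the whole subalgebra which
    that element generates.  Hence if every derivation is determined by its
    value at one element z, a 2-local derivation D is a derivation: let Delta0
    be attached to the pair (z, z); the derivation attached to a pair (z, x)
    agrees with Delta0 at z, so it is Delta0, and D x = Delta0 x.  This is
    [two_local_of_separating].

    For W(a, -1) such an element is z = L_1 + I_k, for any integer k with
    k + a <> 1.  Indeed
      [z, L_0] = L_1 + (k + a) I_k = z + (k + a - 1) I_k,
    so z and the unit L_0, which every derivation kills, generate I_k, hence
    also L_1.  Multiplying by the invertible element L_1 in both directions
    gives every L_n, and then I_m = L_(m - k) I_k.  This is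
    [derivation_determined].

    The condition on k is there for a reason: when a is an integer,
    L_n |-> n I_(n - a), I_m |-> 0 is a derivation, and subtracting from it the
    derivation L_n |-> 0, I_m |-> I_m gives a nonzero derivation that kills
    L_1 + I_(1 - a). *)

Set Implicit Arguments.
Unset Strict Implicit.
Unset Printing Implicit Defensive.

Import GRing.Theory.
Local Open Scope ring_scope.

(** * Linear maps out of a free module *)

Section FreeModule.
Variables (K : nzRingType) (B : choiceType) (V : lmodType K).

Definition free_lift (f : B -> V) (x : {malg K[B]}) : V :=
  \sum_(i <- msupp x) x@_i *: f i.

(** Summing over a support is not visibly additive, since supports vary with
    the argument; a common larger index set removes the dependence. *)
Lemma free_lift_widen (f : B -> V) (d : {fset B}) x :
  (msupp x `<=` d)%fset -> free_lift f x = \sum_(i <- d) x@_i *: f i.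
Proof.
move=> sxd; apply: (big_fset_incl _ sxd) => i _ /mcoeff_outdom ->.
by rewrite scale0r.
Qed.

Lemma free_lift_linear (f : B -> V) : linear (free_lift f).
Proof.
move=> c x y; set d := (msupp (c *: x + y) `|` (msupp x `|` msupp y))%fset.
rewrite !(@free_lift_widen f d) /d ?fsubsetUl //.
- rewrite scaler_sumr -big_split /=; apply: eq_bigr => i _.
  by rewrite mcoeffD mcoeffZ scalerDl scalerA.
- by rewrite fsetUA fsubsetUr.
- by rewrite fsetUCA fsubsetUl.
Qed.

Lemma linear_free_lift (f : {malg K[B]} -> V) :
  linear f -> f =1 free_lift (fun i => f << i >>).
Proof.
move=> lin_f x.
pose F : {linear {malg K[B]} -> V} :=
  HB.pack f (GRing.isLinear.Build _ _ _ _ f lin_f).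
rewrite -[f]/(F : _ -> _) [x in LHS]monalgE raddf_sum.
apply: eq_bigr => i _; rewrite -linearZ; congr (F _).
by apply/malgP => j; rewrite mcoeffZ !mcoeffU mulr_natr.
Qed.

Lemma linear_ext (f g : {malg K[B]} -> V) : linear f -> linear g ->
  (forall i, f << i >> = g << i >>) -> f =1 g.
Proof.
move=> /linear_free_lift fE /linear_free_lift gE eq_fg x.
by rewrite fE gE; apply: eq_bigr => i _; rewrite eq_fg.
Qed.

End FreeModule.

Section Bilinear.
Variables (K : comNzRingType) (B : choiceType) (t : B -> B -> {malg K[B]}).

(** For a fixed second argument, the bilinear extension is the linear extension
    of i |-> (linear extension of t i).  In the other argument the two sums and
    the two coefficients trade places, which uses commutativity of K. *)
Lemma bilin_ext_linearl y : linear (fun x => bilin_ext t x y).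
Proof.
move=> c u v; have E x :
    bilin_ext t x y = free_lift (fun i => free_lift (t i) y) x.
  apply: eq_bigr => i _; rewrite scaler_sumr.
  by apply: eq_bigr => j _; rewrite scalerA.
by rewrite !E free_lift_linear.
Qed.

Lemma bilin_ext_linearr x : linear (bilin_ext t x).
Proof.
move=> c u v; have E y :
    bilin_ext t x y = free_lift (fun j => free_lift (t^~ j) x) y.
  rewrite /bilin_ext exchange_big; apply: eq_bigr => j _; rewrite scaler_sumr.
  by apply: eq_bigr => i _; rewrite scalerA mulrC.
by rewrite !E free_lift_linear.
Qed.

End Bilinear.

(** * Derivations determined by one value *)

Section Separating.
Variables (K : nzRingType) (V : lmodType K) (mul br : V -> V -> V).

Lemma derivation_two_local D :
  derivation mul br D -> two_local_derivation mul br D.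
Proof. by move=> derD x y; exists D. Qed.

Lemma two_local_of_separating (z : V) :
    (forall D E, derivation mul br D -> derivation mul br E ->
       D z = E z -> D =1 E) ->
  forall D, two_local_derivation mul br D -> derivation mul br D.
Proof.
move=> sep D locD; have [E [derE Dz _]] := locD z z.
have DE x : D x = E x.
  have [F [derF Dz' ->]] := locD z x.
  by apply: sep => //; rewrite -Dz -Dz'.
by case: derE => linE mulE brE; split=> [c u v | u v | u v]; rewrite !DE;
   [exact: linE | exact: mulE | exact: brE].
Qed.

(** The Leibniz rule turns agreement at two elements into agreement at their
    product, so the elements where two derivations agree form a subalgebra. *)
Lemma leibniz_agree (op : V -> V -> V) D E x y :
  leibniz op D -> leibniz op E -> D x = E x -> D y = E y ->
  D (op x y) = E (op x y).
Proof. by move=> opD opE Ex Ey; rewrite opD opE Ex Ey. Qed.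

End Separating.

(** * The algebra W(a, -1) *)

Section WAlgebra.
Variable R : realType.
Implicit Types (a : R[i]) (x y : W R) (m n k : int).

Local Notation "x ** y" := (W_mul x y) (at level 40).

Lemma W_mul_linearr x : linear (W_mul x).
Proof. exact: bilin_ext_linearr. Qed.

Lemma W_mulA_L m n x : Lb R m ** (Lb R n ** x) = Lb R (m + n) ** x.
Proof.
move: x; apply: linear_ext => [c u v | c u v | [j | j]].
- by rewrite !W_mul_linearr.
- by rewrite W_mul_linearr.
- by rewrite -/(Lb R j) !W_mulLL addrA.
- by rewrite -/(Ib R j) !W_mulLI addrA.
Qed.

Lemma W_mul1l x : Lb R 0 ** x = x.
Proof.
move: x; apply: linear_ext => [c u v | c u v | [j | j]] //.
- by rewrite W_mul_linearr.
- by rewrite -/(Lb R j) W_mulLL add0r.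
- by rewrite -/(Ib R j) W_mulLI add0r.
Qed.

Lemma W_mulr1 x : x ** Lb R 0 = x.
Proof.
move: x; apply: linear_ext => [c u v | c u v | [j | j]] //.
- exact: bilin_ext_linearl.
- by rewrite -/(Lb R j) W_mulLL addr0.
- by rewrite -/(Ib R j) W_mulIL addr0.
Qed.

Lemma W_mulL_inj n : injective (W_mul (Lb R n)).
Proof.
apply: (can_inj (g := W_mul (Lb R (- n)))) => x.
by rewrite W_mulA_L addNr W_mul1l.
Qed.

Lemma leibniz_L0 (D : W R -> W R) : leibniz (@W_mul R) D -> D (Lb R 0) = 0.
Proof.
move=> /(_ (Lb R 0) (Lb R 0)); rewrite W_mulr1 W_mul1l W_mulr1 => /esym/eqP.
by rewrite -subr_eq0 addrK => /eqP.
Qed.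

(** ad L_0 acts on L_1 with eigenvalue 1 and on I_k with eigenvalue k + a, up to
    a common sign, so bracketing with L_0 splits L_1 + I_k into its two terms
    as soon as the eigenvalues differ. *)
Lemma W_br_L0 a k :
  W_br a (Lb R 1 + Ib R k) (Lb R 0) =
  Lb R 1 + Ib R k + (k%:~R + a - 1) *: Ib R k.
Proof.
have /(_ 1 (Lb R 1) (Ib R k)) := bilin_ext_linearl (br_basis a) (Lb R 0).
rewrite !scale1r -/(W_br a) => ->; rewrite W_brLL W_brIL W_brLI.
rewrite !subr0 add0r scale1r -scaleNr opprK -addrA; congr (_ + _).
by rewrite -[X in _ = X + _]scale1r -scalerDl; congr (_ *: _); ring.
Qed.

(** Since L_1 is invertible, agreement at L_n and agreement at L_(n + 1) are
    equivalent: upwards by the Leibniz rule for L_1 L_n, downwards by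
    cancelling L_1 in it. *)
Lemma derivation_agree_L a (D E : W R -> W R) n :
  derivation (@W_mul R) (W_br a) D -> derivation (@W_mul R) (W_br a) E ->
  D (Lb R 1) = E (Lb R 1) -> D (Lb R n) = E (Lb R n).
Proof.
move=> [_ mulD _] [_ mulE _] DE1.
have step m : D (Lb R m) = E (Lb R m) <-> D (Lb R (1 + m)) = E (Lb R (1 + m)).
  rewrite -W_mulLL; split=> [|]; first exact: leibniz_agree.
  by rewrite mulD mulE DE1 => /addrI/W_mulL_inj.
elim/int_rect: n => [|n|n]; first by rewrite !leibniz_L0.
- by move/step; rewrite -intS.
- by move=> DEn; apply/step; rewrite intS opprD addrA subrr add0r.
Qed.

(** The set where D and E agree is a subalgebra containing L_0.  If it contains
    L_1 + I_k, it contains the bracket of that element with L_0, hence I_k and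
    L_1 separately, and these reach every basis vector. *)
Lemma derivation_determined a k (D E : W R -> W R) :
    k%:~R + a != 1 ->
    derivation (@W_mul R) (W_br a) D -> derivation (@W_mul R) (W_br a) E ->
  D (Lb R 1 + Ib R k) = E (Lb R 1 + Ib R k) -> D =1 E.
Proof.
move=> ka derD derE DEz.
have [linD mulD brD] := derD; have [linE mulE brE] := derE.
have lin_sum (F : W R -> W R) : linear F ->
    forall c u v, F (u + c *: v) = F u + c *: F v.
  by move=> linF c u v; rewrite [u + _]addrC linF addrC.
have DEIk : D (Ib R k) = E (Ib R k).
  have : D (W_br a (Lb R 1 + Ib R k) (Lb R 0)) =
         E (W_br a (Lb R 1 + Ib R k) (Lb R 0)).
    apply: (leibniz_agree brD brE DEz).
    by rewrite (leibniz_L0 mulD) (leibniz_L0 mulE).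
  rewrite W_br_L0 (lin_sum D linD) (lin_sum E linE) DEz => /addrI.
  by apply: scalerI; rewrite subr_eq0.
have DEL1 : D (Lb R 1) = E (Lb R 1).
  by move: DEz; rewrite -[Ib R k]scale1r
    (lin_sum D linD) (lin_sum E linE) !scale1r DEIk => /addIr.
have DEL n := derivation_agree_L n derD derE DEL1.
apply: linear_ext => // -[n | m]; first exact: DEL.
rewrite -/(Ib R m) -[m](subrK k) -W_mulLI.
exact: leibniz_agree mulD mulE (DEL _) DEIk.
Qed.

Lemma exists_shift_neq1 a : exists k, k%:~R + a != 1.
Proof.
have [->|a_neq1] := eqVneq a 1; last by exists 0; rewrite add0r.
by exists 1; rewrite -subr_eq0 addrK oner_eq0.
Qed.

End WAlgebra.

Theorem theorem2p12 (R : realType) (a : R[i]) (D : W R -> W R) :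
  two_local_derivation (@W_mul R) (W_br a) D <->
  derivation (@W_mul R) (W_br a) D.
Proof.
split; last exact: derivation_two_local.
have [k ka] := exists_shift_neq1 a.
apply: (two_local_of_separating (z := Lb R 1 + Ib R k)) => F E.
exact: derivation_determined.
Qed.
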